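(* For $1\le n\le\infty$, in $\mathrm{Ext}_{E(n)}(\mathbb M_2,\mathbb M_2)$ one has \[ v_i(j)\cdot v_k(\ell)-v_i(j+2^{k-i}\ell)\cdot v_k(0)=0 \] for all $0\le i\le k\le n$ and $j,\ell\ge0$ (i.e. the relation, which a priori holds only in the associated graded of the $\rho$-Bockstein filtration, holds exactly, with no $\rho$-divisible correction terms).
   Context: $\mathbb M_2=\mathbb F_2[\tau,\rho]$; $E(n)=(\mathbb M_2,\mathbb M_2[\tau_0,\dots,\tau_n]/(\tau_i^2-\rho\tau_{i+1}\ (i<n),\tau_n^2))$ with $\tau_i$ primitive, $\eta_R(\tau)=\tau+\rho\tau_0$. In the $\rho$-Bockstein spectral sequence $E_1=\mathbb F_2[\rho,\tau,v_0,\dots,v_n]\Rightarrow\mathrm{Ext}_{E(n)}(\mathbb M_2,\mathbb M_2)$ (with $v_i=[\tau_i]$), the elements $\tau^{2^{i+1}j}v_i$ are permanent cycles; $v_i(j)\in\mathrm{Ext}_{E(n)}(\mathbb M_2,\mathbb M_2)$ denotes the class they detect, of tridegree $(2^{i+1}-2,1,2^i-1-2^{i+1}j)$. *)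

(* Defs.v *)
(* Concrete model of the Hopf algebroid E(n) over F_2 and of
   its (unreduced) cobar complex in cohomological degrees 1 and 2. *)
From HB Require Import structures.
From mathcomp Require Import all_boot all_order all_algebra.
Set Implicit Arguments. Unset Strict Implicit. Unset Printing Implicit Defensive.

(* n : nbar, with [Some n] = the finite value n and [None] = infinity. *)
Definition nbar := option nat.
Definition nbar_ge1 (n : nbar) : Prop :=
  match n with Some m => (1 <= m)%N | None => True end.
Definition idx_le (k : nat) (n : nbar) : Prop :=
  match n with Some m => (k <= m)%N | None => True end.

(* A "monomial" (a, b, S) stands for  tau^a rho^b tau_S, where the nat S is a
   bitmask encoding a finite set of indices, tau_S = prod_{i in S} tau_i.
   Since tau_i^2 = rho tau_{i+1} (i<n) and tau_n^2 = 0, Gamma is a free left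
   M_2 = F_2[tau,rho]-module on the square-free monomials tau_S, S a subset
   of {0..n} (of N if n = infinity). *)
Definition mon := (nat * nat * nat)%type.
Definition te (m : mon) : nat := m.1.1.
Definition re (m : mon) : nat := m.1.2.
Definition mk (m : mon) : nat := m.2.

(* F_2-linear combinations are represented by sequences; the element is the
   sum of the entries (so only the parity of multiplicities matters). *)
Definition gam := seq mon.
Definition gam2 := seq (mon * nat).     (* elements of Gamma (x)_{M_2} Gamma:
   (g, T) stands for g (x) tau_T; Gamma (x) Gamma is free as a left
   M_2-module on the tau_S (x) tau_T *)

Definition is_zero {T : eqType} (s : seq T) : Prop :=
  forall t : T, ~~ odd (count_mem t s).

Definition popc (S : nat) : nat := sumn [seq odd (S %/ 2 ^ i) : nat | i <- iota 0 S.+1].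

(* S is a subset of {0..n} *)
Definition valid (n : nbar) (S : nat) : bool :=
  match n with Some m => (S < 2 ^ m.+1)%N | None => true end.

(* tau_S * tau_T = rho^c tau_{S+T} (binary addition, c = number of carries),
   and = 0 if a carry leaves position n (tau_n^2 = 0). *)
Definition mul_mon (n : nbar) (m1 m2 : mon) : gam :=
  let S := (mk m1 + mk m2)%N in
  if valid n S then
    [:: (te m1 + te m2, re m1 + re m2 + (popc (mk m1) + popc (mk m2) - popc S), S)]%N
  else [::].

Definition mulg (n : nbar) (x y : gam) : gam :=
  flatten [seq flatten [seq mul_mon n a b | b <- y] | a <- x].

Definition oneg : gam := [:: (0, 0, 0)%N].

Definition powg (n : nbar) (x : gam) (k : nat) : gam := iter k (fun y => mulg n y x) oneg.

(* right unit: eta_R(tau) = tau + rho tau_0, eta_R(rho) = rho *)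
Definition etaR_tau : gam := [:: (1, 0, 0)%N; (0, 1, 1)%N].
Definition etaR_mon (n : nbar) (a b : nat) : gam :=
  mulg n (powg n etaR_tau a) [:: (0, b, 0)%N].

(* x (x) y in Gamma (x)_{M_2} Gamma, using g (x) tau^a rho^b tau_T
   = g eta_R(tau^a rho^b) (x) tau_T. *)
Definition tens (n : nbar) (x y : gam) : gam2 :=
  flatten [seq [seq (g, mk m) | g <- mulg n x (etaR_mon n (te m) (re m))] | m <- y].

Definition submask (U S : nat) : bool := Nat.land U S == U.

(* coproduct: tau_i primitive, Delta(tau) = tau (x) 1, Delta(rho) = rho (x) 1,
   so Delta(tau^a rho^b tau_S) = sum_{U subset S} tau^a rho^b tau_U (x) tau_{S\U} *)
Definition Delta (x : gam) : gam2 :=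
  flatten [seq [seq ((te m, re m, U), (mk m - U)%N)
               | U <- iota 0 (mk m).+1 & submask U (mk m)] | m <- x].

(* cobar differential C^1 = Gamma -> C^2 = Gamma (x) Gamma (signs irrelevant mod 2):
   d(x) = 1 (x) x - Delta(x) + x (x) 1 *)
Definition d1 (n : nbar) (x : gam) : gam2 := tens n oneg x ++ Delta x ++ tens n x oneg.

Definition is_elt (n : nbar) (x : gam) : Prop :=
  forall m : mon, odd (count_mem m x) -> valid n (mk m).

(* motivic bidegree (topological degree, weight) of a monomial:
   |tau| = (0,-1), |rho| = (-1,-1), |tau_i| = (2^(i+1)-1, 2^i-1). *)
Definition tdeg (m : mon) : int := ((2 * mk m)%N%:Z - (popc (mk m))%:Z - (re m)%:Z)%R.
Definition wdeg (m : mon) : int :=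
  ((mk m)%:Z - (popc (mk m))%:Z - (te m)%:Z - (re m)%:Z)%R.

Definition homogeneous (x : gam) (t w : int) : Prop :=
  forall m : mon, odd (count_mem m x) -> tdeg m = t /\ wdeg m = w.

(* The monomial tau^(2^(i+1) j) tau_i in Gamma; its cobar class [.] is the E_1
   element tau^(2^(i+1) j) v_i. *)
Definition vmon (i j : nat) : mon := (2 ^ i.+1 * j, 0, 2 ^ i)%N.

(* c is a cobar 1-cocycle representing a class of Ext^1_{E(n)}, homogeneous of
   the tridegree of v_i(j), detected in the rho-Bockstein spectral sequence by
   tau^(2^(i+1) j) v_i, i.e. in rho-filtration 0 with reduction mod rho equal to
   tau^(2^(i+1) j) tau_i (mod rho, the cobar 1-coboundaries vanish). *)
Definition is_vrep (n : nbar) (i j : nat) (c : gam) : Prop :=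
  [/\ is_elt n c,
      homogeneous c (tdeg (vmon i j)) (wdeg (vmon i j)),
      is_zero (d1 n c)
    & forall m : mon, re m = 0%N -> odd (count_mem m c) = (m == vmon i j)].

Definition ext2_zero (n : nbar) (u : gam2) : Prop :=
  exists z : gam, is_elt n z /\ is_zero (u ++ d1 n z).

(* Main.v *)
(* Put A = 2^i (2j+1). The class v_i(j) is represented by
   (eta_R(tau^A) - tau^A) / rho^(2^(i+1)-1), and this is the only cocycle of its
   tridegree detected by tau^(2^(i+1) j) v_i: writing a cocycle as
   sum_S f_S tau_S, the coefficient of tau_U (x) tau_T in the cocycle condition
   expresses f_(U u T) through f_T, and comparing the two expressions for
   f_({i} u S) determines every f_S from f_i.

   With B = 2^k (2l+1), the cobar differentials of tau^A v_k(l) and of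
   tau^(A + 2^(k+1) l) tau_k are rho^(2^(i+1)-1) times the two products. The sum
   of these two cochains is divisible by rho^(2^(i+1)-1), because the tau_k-terms
   cancel and every other term of v_k(l) carries at least rho^(2^(k+1)). The
   quotient is the required bounding cochain. *)
Require Import Defs.
From mathcomp Require Import all_boot all_order all_algebra.
From mathcomp Require Import zify.
Set Implicit Arguments. Unset Strict Implicit. Unset Printing Implicit Defensive.
Import GRing.Theory.

(** * Binomial coefficients modulo 2 and binary digits *)

Lemma half_ind (P : nat -> Prop) :
  P 0 -> (forall n, 0 < n -> P n./2 -> P n) -> forall n, P n.
Proof.
move=> P0 PS n; have [k] := ubnP n; elim: k n => // k IH [|n] //= lt_nk.
by apply: PS => //; apply: IH; lia.
Qed.

(** These are the coefficients of (1+X)^(2n) = (1+X^2)^n modulo 2; the induction applies Pascal's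
    rule twice. *)
Lemma odd_bin_double n m :
  odd 'C(n.*2, m.*2) = odd 'C(n, m) /\ odd 'C(n.*2, m.*2.+1) = false.
Proof.
elim: n m => [|n IH] [|m]; rewrite ?bin0 ?bin0n ?bin1 ?odd_double //.
rewrite doubleS binS [in X in _ /\ X]binS.
case: (IH m) => e1 e2; case: (IH m.+1) => e3 e4.
rewrite !doubleS in e3 e4 *.
rewrite !binS !oddD e1 e2 e3 e4.
by case: (odd _); case: (odd _).
Qed.

(** Lucas's theorem at 2, for the lowest binary digit. *)
Lemma odd_bin_half n m :
  odd 'C(n, m) = (odd m ==> odd n) && odd 'C(n./2, m./2).
Proof.
rewrite -{1}[n]odd_double_half -{1}[m]odd_double_half.
case: (odd n); case: (odd m); rewrite ?add0n ?add1n /=.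
- rewrite binS oddD; case: (odd_bin_double n./2 m./2) => -> _.
  by have [_ ->] := odd_bin_double n./2 m./2.
- case: m./2 => [|m']; first by rewrite !bin0.
  rewrite doubleS binS oddD -doubleS.
  have [-> _] := odd_bin_double n./2 m'.+1.
  by have [_ ->] := odd_bin_double n./2 m'; rewrite addbF.
- by have [_ ->] := odd_bin_double n./2 m./2.
- by have [-> _] := odd_bin_double n./2 m./2.
Qed.

Lemma odd_bin_exp2 n i : odd 'C(n, 2 ^ i) = odd (n %/ 2 ^ i).
Proof.
elim: i n => [|i IH] n; first by rewrite bin1 divn1.
rewrite odd_bin_half expnS mul2n odd_double doubleK IH -divn2 -divnMA.
by rewrite mul2n.
Qed.

(** Both sides count pairs of disjoint subsets of sizes [m] and [p]. It matches binomials from the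
    coproduct with those from the right unit. *)
Lemma bin_mul_bin n m p : 'C(n, m + p) * 'C(m + p, m) = 'C(n, m) * 'C(n - m, p).
Proof.
have [le_n|lt_n] := leqP (m + p) n; last first.
  rewrite bin_small // mul0n; have [lt_nm|le_mn] := ltnP n m.
    by rewrite bin_small.
  by rewrite (@bin_small (n - m)) ?muln0 //; lia.
have f_gt0 : 0 < m`! * p`! * (n - m - p)`! by rewrite !muln_gt0 !fact_gt0.
apply/eqP; rewrite -(eqn_pmul2r f_gt0); apply/eqP.
have e1 := bin_fact le_n.
have e2 := @bin_fact (m + p) m (leq_addr _ _); rewrite addKn in e2.
have e3 := @bin_fact n m ltac:(lia).
have e4 := @bin_fact (n - m) p ltac:(lia).
rewrite subnDA in e1.
transitivity n`!; first by rewrite -e1 -e2 !mulnA.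
by rewrite -e3 -e4 -!mulnA; congr (_ * _); rewrite mulnCA.
Qed.

Lemma odd_bin_dvd i a S : odd 'C(2 ^ i * a, S) -> (2 ^ i %| S)%N.
Proof.
elim: i a S => [|i IH] a S; first by rewrite dvd1n.
rewrite odd_bin_half expnS -mulnA mul2n odd_double implybF doubleK.
by case/andP=> nS /IH dS; rewrite -(even_halfK nS) -muln2 mulnC dvdn_pmul2r.
Qed.

(** The binary digits of [2 ^ i * q] and [T] occupy disjoint positions, so adding them produces no
    carry. *)
Lemma odd_bin_disjoint i q T : (T < 2 ^ i)%N -> odd 'C(2 ^ i * q + T, 2 ^ i * q).
Proof.
elim: i T => [|i IH] T; first by case: T => // _; rewrite addn0 binn.
rewrite expnS => ltT; rewrite odd_bin_half -mulnA mul2n odd_double doubleK /=.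
have -> : ((2 ^ i * q).*2 + T)./2 = (2 ^ i * q + T./2)%N by lia.
by apply: IH; lia.
Qed.

Lemma binCD S T : 'C(S + T, S) = 'C(S + T, T).
Proof. by rewrite -bin_sub ?leq_addr // addKn. Qed.

Lemma odd_bin_exp2_eq k T : (0 < T)%N -> odd 'C(2 ^ k, T) = (T == 2 ^ k)%N.
Proof.
move=> T0; case: eqP => [->|neq]; first by rewrite binn.
apply/negbTE/negP => h; have := @odd_bin_dvd k 1 T; rewrite muln1 => /(_ h).
move=> /(dvdn_leq T0) le_kT; have : (2 ^ k < T)%N by lia.
by move=> lt; rewrite bin_small in h.
Qed.

Lemma land_half U S :
  Nat.land U S = (odd U && odd S) + (Nat.land U./2 S./2).*2.
Proof.
have half2 m : Nat.div2 m = m./2 by elim/ltn_ind: m => -[|[|m]] //= IH; rewrite IH.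
have oddE m : Nat.odd m = odd m.
  by elim/ltn_ind: m => -[|[|m]] //= IH; rewrite negbK -IH.
rewrite -{1}[U]odd_double_half -mul2n; case: (odd U) => /=.
  by rewrite addnC PeanoNat.Nat.land_odd_l half2 oddE; case: (odd S) => /=; lia.
by rewrite add0n PeanoNat.Nat.land_even_l half2; lia.
Qed.

(** By Lucas, both sides compare binary digits position by position. *)
Lemma submask_bin U S : submask U S = odd 'C(S, U).
Proof.
rewrite /submask; elim/half_ind: S U => [|S S0 IH] U.
  by rewrite PeanoNat.Nat.land_0_r bin0n; case: U.
rewrite odd_bin_half -IH land_half -[in X in _ == X](odd_double_half U).
by case: (odd U); case: (odd S) => /=; lia.
Qed.

Lemma popc_half S : popc S = odd S + popc S./2.
Proof.
(* The range in [popc S] depends on [S]; [pc] frees this bound so that digits can be shifted. *)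
pose pc K s := sumn [seq odd (s %/ 2 ^ i) : nat | i <- iota 0 K].
have pcS K s : pc K.+1 s = odd s + pc K s./2.
  rewrite /pc /= divn1; congr (_ + sumn _).
  rewrite (iotaDl 1 0) -map_comp; apply: eq_map => i /=.
  by rewrite add1n expnS divnMA divn2.
have pc_stable K s : s <= K -> pc K s = pc s s.
  elim: K => [|K IH]; first by case: s.
  rewrite leq_eqVlt => /orP[/eqP-> //|lt_sK]; rewrite -IH //.
  rewrite /pc -[K.+1]addn1 iotaD map_cat sumn_cat /= divn_small ?addn0 //.
  by rewrite (leq_ltn_trans _ (ltn_expl K (ltnSn 1))).
rewrite -[popc S]/(pc S.+1 S) -[popc S./2]/(pc S./2.+1 S./2) pcS.
case: (posnP S) => [-> //|S0].
by rewrite (@pc_stable S) ?(@pc_stable S./2.+1) //; lia.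
Qed.

(** The incoming carry [c] makes the induction on digits close; the conditional in the proof is the
    carry out of the lowest position. *)
Lemma popc_add_carry S T (c : bool) : popc (S + T + c) <= popc S + popc T + c.
Proof.
have [k] := ubnP (S + T); elim: k S T c => // k IH S T c lt_k.
have [/eqP|ST0] := posnP (S + T).
  by rewrite addn_eq0 => /andP[/eqP-> /eqP->]; case: c.
rewrite popc_half (popc_half S) (popc_half T).
have := IH S./2 T./2 (if odd S then odd T || c else odd T && c) ltac:(lia).
have -> : (S + T + c)./2
   = S./2 + T./2 + (if odd S then odd T || c else odd T && c).
  by case: c; case: ifP; lia.
by rewrite !oddD oddb; case: (odd S); case: (odd T); case: c => /=; lia.
Qed.

Lemma leq_popcD S T : popc (S + T) <= popc S + popc T.
Proof. by have := popc_add_carry S T false; rewrite !addn0. Qed.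

Lemma odd_bin_add_half S T : odd 'C(S + T, S) ->
  [/\ ~~ (odd S && odd T), (S + T)./2 = S./2 + T./2
    & odd 'C(S./2 + T./2, S./2)].
Proof.
rewrite odd_bin_half oddD => /andP[h1 h2].
have nST : ~~ (odd S && odd T) by move: h1; case: (odd S); case: (odd T).
have e : (S + T)./2 = S./2 + T./2 by lia.
by rewrite -e.
Qed.

(** By Kummer, an odd binomial means addition without carries, so digit sums add. *)
Lemma popcD S T : odd 'C(S + T, S) -> popc (S + T) = popc S + popc T.
Proof.
have [k] := ubnP (S + T); elim: k S T => // k IH S T lt_k.
have [/eqP|ST0] := posnP (S + T).
  by rewrite addn_eq0 => /andP[/eqP-> /eqP->].
move=> /odd_bin_add_half[nST e h].
rewrite popc_half (popc_half S) (popc_half T) e IH //; last by lia.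
by rewrite oddD; case: (odd S) nST; case: (odd T) => //=; lia.
Qed.

(** Carry-free addition creates no new leading digit; for finite n this keeps disjoint unions of
    index sets inside {0..n}. *)
Lemma ltn_exp2D K S T : odd 'C(S + T, S) -> S < 2 ^ K -> T < 2 ^ K -> S + T < 2 ^ K.
Proof.
elim: K S T => [|K IH] S T; first by case: S; case: T.
rewrite expnS => /odd_bin_add_half[nST e h] ltS ltT.
by have := IH _ _ h ltac:(lia) ltac:(lia); lia.
Qed.

Lemma popc_exp2 i : popc (2 ^ i) = 1.
Proof.
elim: i => // i IH; rewrite popc_half expnS mul2n odd_double doubleK IH.
by [].
Qed.

Lemma popc_leq S : popc S <= S.
Proof. by elim/half_ind: S => // S S0 IH; rewrite popc_half; lia. Qed.

(* [rw S] is the power of rho with rho^(rw S) tau_S = (rho tau_0)^S. *)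
Definition rw S := 2 * S - popc S.

Lemma rwE S : rw S + popc S = 2 * S.
Proof. by rewrite /rw; have := popc_leq S; lia. Qed.

(** Passing to the successor adds 2 to [2 * S] and at most 1 to [popc S]. *)
Lemma ltn_rw S T : S < T -> rw S < rw T.
Proof.
elim: T => // T IH; rewrite ltnS => le_ST.
have ltT : rw T < rw T.+1.
  have := leq_popcD T 1; rewrite addn1 (_ : popc 1 = 1) //.
  by have := rwE T; have := rwE T.+1; lia.
by move: le_ST; rewrite leq_eqVlt => /orP[/eqP-> //|/IH lt]; lia.
Qed.

Lemma leq_rw S T : S <= T -> rw S <= rw T.
Proof. by rewrite leq_eqVlt => /orP[/eqP->|/ltn_rw/ltnW]. Qed.

Lemma rw_exp2 i : rw (2 ^ i) = 2 ^ i.+1 - 1.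
Proof. by rewrite /rw popc_exp2 expnS. Qed.

Local Open Scope ring_scope.

(** * Parity classes of sequences *)

Definition cf (T : eqType) (t : T) (s : seq T) : 'F_2 := (count_mem t s)%:R.

Lemma natrF2 n : n%:R = (odd n)%:R :> 'F_2.
Proof.
rewrite -{1}[n]odd_double_half natrD -muln2 natrM.
by rewrite (_ : 2%:R = 0 :> 'F_2) ?mulr0 ?addr0 //; apply/val_inj.
Qed.

Lemma addrF2 (a : 'F_2) : a + a = 0.
Proof. by rewrite -mulr2n -mulr_natl natrF2 mul0r. Qed.

Lemma addrF2_eq0 (a b : 'F_2) : a + b = 0 -> a = b.
Proof.
by move/eqP; rewrite addr_eq0 => /eqP->; rewrite -[LHS]add0r -(addrF2 b) addrK.
Qed.

Lemma oppF2 (a : 'F_2) : - a = a.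
Proof. by apply: addrF2_eq0; rewrite addNr. Qed.

Lemma cf_odd (T : eqType) (t : T) s : cf t s = (odd (count_mem t s))%:R.
Proof. exact: natrF2. Qed.

Lemma is_zeroP (T : eqType) (s : seq T) : is_zero s <-> forall t, cf t s = 0.
Proof.
by split=> h t; move: (h t); rewrite cf_odd; case: odd.
Qed.

Lemma cf_cat (T : eqType) (t : T) s1 s2 : cf t (s1 ++ s2) = cf t s1 + cf t s2.
Proof. by rewrite /cf count_cat natrD. Qed.

Lemma cf_flatten (T U : eqType) (t : U) (G : T -> seq U) s :
  cf t (flatten [seq G m | m <- s]) = \sum_(m <- s) cf t (G m).
Proof.
by elim: s => [|m s IH]; rewrite ?big_nil // big_cons -IH -cf_cat.
Qed.

Lemma cf_sum (T : eqType) (t : T) s : cf t s = \sum_(u <- s) (u == t)%:R.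
Proof.
by elim: s => [|u s IH]; rewrite ?big_nil // big_cons -IH /cf /= natrD.
Qed.

Definition parity_eq (T : eqType) (s1 s2 : seq T) := forall t, cf t s1 = cf t s2.

(** Both sums are regrouped over the distinct entries [r], where only the coefficients matter. *)
Lemma parity_eq_sum (T : eqType) (s1 s2 : seq T) (F : T -> 'F_2) :
  parity_eq s1 s2 -> \sum_(m <- s1) F m = \sum_(m <- s2) F m.
Proof.
move=> eq12; pose r := undup (s1 ++ s2).
have sumE s : {subset s <= r} -> \sum_(m <- s) F m = \sum_(u <- r) cf u s * F u.
  move=> sub_r; under [RHS]eq_bigr => u _ do rewrite cf_sum mulr_suml.
  rewrite exchange_big /=; apply: eq_big_seq => m /sub_r mr.
  rewrite (bigD1_seq m) ?undup_uniq //= eqxx mul1r big1 ?addr0 // => u.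
  by rewrite eq_sym => /negbTE->; rewrite mul0r.
rewrite !sumE; first by apply: eq_bigr => u _; rewrite eq12.
  by move=> m ms; rewrite mem_undup mem_cat ms orbT.
by move=> m ms; rewrite mem_undup mem_cat ms.
Qed.

(** Normal form in which membership means having a nonzero coefficient, so that conditions on odd
    multiplicities become conditions on all entries. *)
Definition reduce (T : eqType) (s : seq T) := [seq m <- undup s | odd (count_mem m s)].

Lemma mem_reduce (T : eqType) (s : seq T) m : m \in reduce s = odd (count_mem m s).
Proof.
rewrite mem_filter mem_undup -has_pred1 has_count.
by case: (count_mem m s) => //= k; rewrite andbT.
Qed.

Lemma reduce_parity (T : eqType) (s : seq T) : parity_eq s (reduce s).
Proof.
move=> t; rewrite cf_odd /cf (@count_uniq_mem _ (reduce s)) ?mem_reduce //.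
by rewrite filter_uniq ?undup_uniq.
Qed.

Lemma cf_map_pair (T U : eqType) (s : seq T) (g : T) (v w : U) :
  cf (g, v) [seq (h, w) | h <- s] = (w == v)%:R * cf g s.
Proof.
rewrite !cf_sum big_map mulr_sumr; apply: eq_bigr => h _.
by rewrite xpair_eqE andbC -natrM mulnb.
Qed.

Lemma cf_tens n x y g T : cf (g, T) (tens n x y) =
  \sum_(m <- y) (mk m == T)%:R * cf g (mulg n x (etaR_mon n (te m) (re m))).
Proof. by rewrite cf_flatten; apply: eq_bigr => m _; rewrite cf_map_pair. Qed.

Lemma mulg_parity n x1 x2 y : parity_eq x1 x2 ->
  parity_eq (mulg n x1 y) (mulg n x2 y).
Proof. by move=> eq12 t; rewrite !cf_flatten; apply: parity_eq_sum. Qed.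

Lemma tens_parity n x1 x2 y1 y2 : parity_eq x1 x2 -> parity_eq y1 y2 ->
  parity_eq (tens n x1 y1) (tens n x2 y2).
Proof.
move=> eqx eqy [g T]; rewrite !cf_tens (parity_eq_sum _ eqy).
by apply: eq_bigr => m _; rewrite (mulg_parity n _ eqx).
Qed.

Lemma cf_d1 n x t :
  cf t (d1 n x) = cf t (tens n oneg x) + (cf t (Delta x) + cf t (tens n x oneg)).
Proof. by rewrite -[in RHS]cf_cat -[in RHS]cf_cat. Qed.

Lemma d1_parity n x1 x2 : parity_eq x1 x2 -> parity_eq (d1 n x1) (d1 n x2).
Proof.
move=> eqx t; rewrite !cf_d1.
have one : parity_eq oneg oneg by [].
rewrite (tens_parity n one eqx t) (tens_parity n eqx one t).
by rewrite !cf_flatten (parity_eq_sum _ eqx).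
Qed.

Lemma valid_leq n S T : (S <= T)%N -> valid n T -> valid n S.
Proof. by case: n => //= m; apply: leq_ltn_trans. Qed.

Lemma validD n S T : odd 'C(S + T, S) -> valid n S -> valid n T -> valid n (S + T).
Proof. by case: n => //= m; apply: ltn_exp2D. Qed.

(** * Homogeneous elements as truncated polynomials *)

(* Equality modulo X^(2^(n+1)). *)
Definition eqt n (p q : {poly 'F_2}) := forall S, valid n S -> p`_S = q`_S.

Lemma eqtM n p1 p2 q1 q2 : eqt n p1 p2 -> eqt n q1 q2 -> eqt n (p1 * q1) (p2 * q2).
Proof.
move=> eqp eqq S vS; rewrite !coefM; apply: eq_bigr => j _.
by rewrite eqp ?eqq //; apply: valid_leq vS; rewrite ?leq_subr // -ltnS.
Qed.

(* Substituting t := rho tau_0, Gamma becomes a subring of F_2[tau, rho^-1, rho, t]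
   modulo t^(2^(n+1)), in which tau^a rho^b tau_S is tau^a rho^(-tdeg) t^S and
   eta_R(tau) = tau + t. A homogeneous element is thus determined by its degree
   and by its dehomogenization [psi] at tau = rho = 1. *)
Definition psi (x : gam) : {poly 'F_2} := \sum_(m <- x) 'X^(mk m).

(** [N] is the total degree in tau and t, which equals [tdeg m - wdeg m]. *)
Definition homog n (t : int) (N : nat) (x : gam) := forall m, m \in x ->
  [/\ tdeg m = t, (te m + mk m)%N = N & valid n (mk m)].

Lemma mon_inj m1 m2 : tdeg m1 = tdeg m2 -> (te m1 + mk m1 = te m2 + mk m2)%N ->
  mk m1 = mk m2 -> m1 = m2.
Proof.
case: m1 m2 => [[a1 b1] S1] [[a2 b2] S2]; rewrite /tdeg /te /re /mk /= => h1 h2 e.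
by subst S2; congr (_, _, _); lia.
Qed.

Lemma coef_psi x S : (psi x)`_S = \sum_(m <- x) (mk m == S)%:R.
Proof. by rewrite coef_sum; apply: eq_bigr => m _; rewrite coefXn eq_sym. Qed.

Lemma psi_invalid n t N x S : homog n t N x -> ~~ valid n S -> (psi x)`_S = 0.
Proof.
move=> hx nvS; rewrite coef_psi big_seq big1 // => m /hx[_ _ vm].
by case: eqP => // e; rewrite -e vm in nvS.
Qed.

Lemma psi_large n t N x S : homog n t N x -> (N < S)%N -> (psi x)`_S = 0.
Proof.
move=> hx ltS; rewrite coef_psi big_seq big1 // => m /hx[_ e _].
by case: eqP => // e'; lia.
Qed.

(** The rho-exponent of an entry at [S] is [rw S - t], which cannot be negative. *)
Lemma psi_small n (t : nat) N x S : homog n t%:Z N x -> (rw S < t)%N -> (psi x)`_S = 0.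
Proof.
move=> hx ltS; rewrite coef_psi big_seq big1 // => m /hx[e _ _].
by case: eqP => // e'; move: e; rewrite /tdeg e'; have := rwE S; lia.
Qed.

Lemma cf_hom n t N x m : homog n t N x ->
  cf m x = ((tdeg m == t) && (te m + mk m == N)%N)%:R * (psi x)`_(mk m).
Proof.
move=> hx; rewrite cf_sum coef_psi mulr_sumr; apply: eq_big_seq => u /hx[e1 e2 _].
rewrite -natrM mulnb; congr (nat_of_bool _)%:R.
apply/eqP/idP => [<-|]; first by rewrite e1 e2 !eqxx.
case/andP => /andP[/eqP h1 /eqP h2] /eqP h3.
by apply: mon_inj; rewrite ?h1 ?h2.
Qed.

Lemma hom_mulg n t1 N1 x t2 N2 y : homog n t1 N1 x -> homog n t2 N2 y ->
  homog n (t1 + t2) (N1 + N2) (mulg n x y).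
Proof.
move=> hx hy m /flatten_mapP[[[a1 b1] S1] /hx[]].
rewrite /tdeg /te /re /mk /= => e1 e2 v1 /flatten_mapP[[[a2 b2] S2] /hy[]].
rewrite /mul_mon /tdeg /te /re /mk /= => e3 e4 v2.
case: ifP => // v; rewrite inE => /eqP->; split=> //=; last by lia.
by have := leq_popcD S1 S2; lia.
Qed.

(** Setting rho = 1 forgets carries, and a product dropped by [mul_mon] has an invalid exponent;
    hence equality only up to truncation. *)
Lemma psi_mulg n x y : eqt n (psi (mulg n x y)) (psi x * psi y).
Proof.
move=> S vS.
have psi_flatten (G : mon -> gam) s :
    psi (flatten [seq G m | m <- s]) = \sum_(m <- s) psi (G m).
  by rewrite /psi big_flatten big_map.
rewrite psi_flatten /psi mulr_suml !coef_sum; apply: eq_bigr => a _.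
rewrite -/(psi _) psi_flatten mulr_sumr !coef_sum; apply: eq_bigr => b _.
rewrite -exprD coefXn /mul_mon; case: ifP => v; first by rewrite /psi big_seq1 coefXn.
by rewrite /psi big_nil coef0; case: eqP => // e; rewrite -e vS in v.
Qed.

Lemma valid0 n : valid n 0.
Proof. by case: n => //= m; rewrite expn_gt0. Qed.

Lemma hom_oneg n : homog n 0 0 oneg.
Proof. by move=> m; rewrite inE => /eqP->; split=> //; apply: valid0. Qed.

Lemma psi_oneg : psi oneg = 1.
Proof. by rewrite /psi big_seq1. Qed.

Lemma hom_etaR n a b : homog n (- b%:Z) a (etaR_mon n a b).
Proof.
have htau : homog n 0 1 etaR_tau.
  move=> m; rewrite !inE => /orP[]/eqP->; split=> //; first exact: valid0.
  by case: n => //= m'; rewrite -(expn0 2) ltn_exp2l.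
have hpow : homog n 0 a (powg n etaR_tau a).
  elim: a => [|a IH]; first exact: hom_oneg.
  by have := hom_mulg IH htau; rewrite addr0 addn1.
have hrho : homog n (- b%:Z) 0 [:: (0, b, 0)%N].
  by move=> m; rewrite inE => /eqP->; split=> //; [rewrite /tdeg sub0r|apply: valid0].
by have := hom_mulg hpow hrho; rewrite add0r addn0.
Qed.

Lemma psi_etaR n a b : eqt n (psi (etaR_mon n a b)) ((1 + 'X) ^+ a).
Proof.
have hpow : eqt n (psi (powg n etaR_tau a)) ((1 + 'X) ^+ a).
  elim: a => [|a IH] S vS; first by rewrite psi_oneg.
  rewrite exprSr psi_mulg //; apply: eqtM S vS => //.
  by rewrite /psi !big_cons big_nil addr0.
move=> S vS; rewrite psi_mulg // -[(1 + 'X) ^+ a]mulr1.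
by apply: eqtM S vS => // S _; rewrite /psi big_seq1.
Qed.

Lemma coef_binom a S : ((1 + 'X) ^+ a : {poly 'F_2})`_S = 'C(a, S)%:R.
Proof.
rewrite exprDn coef_sum; have [lt_aS|le_Sa] := ltnP a S.
  rewrite bin_small // big1 // => i _; rewrite expr1n mul1r coefMn coefXn.
  by case: eqP => [e|]; rewrite ?mul0rn //; have := ltn_ord i; lia.
rewrite (bigD1 (Ordinal (le_Sa : (S < a.+1)%N))) //= expr1n mul1r coefMn coefXn eqxx.
rewrite big1 ?addr0 // => i neq; rewrite expr1n mul1r coefMn coefXn.
by case: eqP => [e|]; rewrite ?mul0rn //; case/eqP: neq; apply/val_inj.
Qed.

(** * Coefficients of tensor products and of the cobar differential *)

Definition bideg_eq (t : int) (N : nat) (g : mon) (T : nat) : bool :=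
  (tdeg g + (rw T)%:Z == t) && (te g + mk g + T == N)%N.

(** The entry of [y] at [T] carries tau^(N2-T); moved across the tensor sign by the right unit, it
    becomes (tau+t)^(N2-T). *)
Lemma cf_tens_hom n t1 N1 x t2 N2 y g T : homog n t1 N1 x -> homog n t2 N2 y ->
  cf (g, T) (tens n x y) = (bideg_eq (t1 + t2) (N1 + N2) g T && valid n (mk g))%:R
     * ((psi y)`_T * (psi x * (1 + 'X) ^+ (N2 - T))`_(mk g)).
Proof.
move=> hx hy; rewrite cf_tens coef_psi mulr_suml mulr_sumr.
apply: eq_big_seq => m /hy[e1 e2 vm].
case: (mk m =P T) => [eT|_]; last by rewrite !mul0r mulr0.
have hom_m := hom_mulg hx (@hom_etaR n (te m) (re m)).
rewrite !mul1r (cf_hom _ hom_m) /bideg_eq.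
have -> : (N2 - T = te m)%N by lia.
have -> : (tdeg g == t1 - (re m)%:Z) = (tdeg g + (rw T)%:Z == t1 + t2).
  by apply/eqP/eqP; move: e1; rewrite /tdeg eT; have := rwE T; lia.
have -> : (te g + mk g == N1 + te m)%N = (te g + mk g + T == N1 + N2)%N.
  by apply/eqP/eqP; lia.
have [vg|nvg] := boolP (valid n (mk g)); last first.
  by rewrite andbF mul0r (psi_invalid hom_m nvg) mulr0.
rewrite andbT psi_mulg //; congr (_ * _).
by apply: eqtM vg => //; apply: psi_etaR.
Qed.

(** The binomial tests whether the two masks are disjoint; if so, [popcD] makes their degrees add
    up. *)
Lemma cf_Delta_hom n t N x g T : homog n t N x ->
  cf (g, T) (Delta x) = (bideg_eq t N g T)%:R
     * ('C(mk g + T, mk g)%:R * (psi x)`_(mk g + T)).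
Proof.
move=> hx; rewrite cf_flatten (natrF2 'C(_, _)) coef_psi !mulr_sumr.
case: g => [[a b] S]; rewrite /bideg_eq.
apply: eq_big_seq => -[[a' b'] S'] /hx[e1 e2 vm].
rewrite -!natrM !mulnb /cf count_map count_filter.
rewrite /tdeg /te /re /mk ![(_, _).1]/= ![(_, _).2]/= in e1 e2 vm *.
pose c := [&& a' == a, b' == b, S' == (S + T)%N & submask S S'].
rewrite (eq_in_count (a2 := fun U => c && (U == S))); last first.
  move=> U; rewrite mem_iota add0n ltnS /= => leU; rewrite !xpair_eqE /c.
  case: (U =P S) => [eU|_]; last by rewrite !andbF.
  rewrite eU in leU *.
  rewrite !andbT -!andbA; do 2 congr (_ && _).
  by congr (_ && _); apply/eqP/eqP; lia.
have -> : count (fun U => c && (U == S)) (iota 0 S'.+1) = c.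
  case: (boolP c) => [/and4P[_ _ /eqP eS' _]|_]; last exact: count_pred0.
  rewrite [LHS](count_uniq_mem S (iota_uniq 0 S'.+1)) mem_iota eS'.
  by rewrite add0n ltnS leq_addr.
congr (nat_of_bool _)%:R; rewrite /c submask_bin.
case: (S' =P (S + T)%N) => [eS'|_]; last by rewrite !andbF.
rewrite eS' andbT; case: (boolP (odd _)) => [h|_]; last by rewrite !andbF.
rewrite !andbT /=; have eP := popcD h; have eT := rwE T.
by rewrite eS' in e1 e2; apply/andP/andP => -[/eqP h1 /eqP h2]; split; apply/eqP; lia.
Qed.

(** The summands come from 1 (x) x, Delta(x) and x (x) 1, in this order, after setting tau = rho =
    1. *)
Definition d1_coef (p : {poly 'F_2}) N S T : 'F_2 :=
  p`_T * 'C(N - T, S)%:R + 'C(S + T, S)%:R * p`_(S + T) + (T == 0)%N%:R * p`_S.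

Lemma cf_d1_hom n t N x g T : homog n t N x ->
  cf (g, T) (d1 n x) =
    (bideg_eq t N g T && valid n (mk g))%:R * d1_coef (psi x) N (mk g) T.
Proof.
move=> hx; rewrite cf_d1 (cf_Delta_hom _ _ hx).
rewrite (cf_tens_hom _ _ (@hom_oneg n) hx) (cf_tens_hom _ _ hx (@hom_oneg n)).
rewrite add0r add0n addr0 addn0 psi_oneg mul1r sub0n expr0 mulr1 coef_binom coef1.
have [vg|nvg] := boolP (valid n (mk g)); last first.
  rewrite andbF !mul0r add0r addr0 (psi_invalid hx) ?mulr0 //.
  by apply: contra nvg; apply: valid_leq; rewrite leq_addr.
by rewrite andbT -!mulrDr /d1_coef addrA.
Qed.

(** * The cocycles representing v_i(j) *)

Lemma d1_coef_eq0 n (t N : nat) x S T : homog n t%:Z N x -> is_zero (d1 n x) ->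
  (0 < T)%N -> valid n S ->
  (psi x)`_T * 'C(N - T, S)%:R = 'C(S + T, S)%:R * (psi x)`_(S + T).
Proof.
move=> hx /is_zeroP zx T0 vS.
(* The cocycle condition yields an equation only if the exponents of tau and rho are nonnegative. In
   the first two cases one of them would be negative, and both sides vanish. *)
have [ltN|leN] := ltnP N (S + T).
  rewrite (psi_large hx ltN) mulr0; have [ltT|leT] := ltnP N T.
    by rewrite (psi_large hx ltT) mul0r.
  by rewrite bin_small ?mulr0 //; lia.
have [ltt|let_] := ltnP (rw S + rw T) t.
  rewrite (psi_small (S := T) hx) ?mul0r; last by lia.
  have [h|nh] := boolP (odd 'C(S + T, S)); last first.
    by rewrite natrF2 (negbTE nh) mul0r.
  rewrite (psi_small (S := (S + T)%N) hx) ?mulr0 //.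
  by have := popcD h; have := rwE S; have := rwE T; have := rwE (S + T); lia.
have := zx ((N - S - T, rw S + rw T - t, S)%N, T).
rewrite (cf_d1_hom _ _ hx) /bideg_eq /tdeg /te /re /mk /= vS andbT.
have -> : (2 * S)%N%:Z - (popc S)%:Z - (rw S + rw T - t)%N%:Z + (rw T)%:Z == t%:Z.
  by apply/eqP; have := rwE S; lia.
have -> : (N - S - T + S + T == N)%N by apply/eqP; lia.
rewrite mul1r /d1_coef eqn0Ngt T0 mul0r addr0.
exact: addrF2_eq0.
Qed.

(** The target is the dehomogenization of (eta_R(tau^A) - tau^A) / rho^(2^(i+1)-1), so all
    representatives agree up to parity. *)
Lemma vrep_psi n i j x : idx_le i n -> is_vrep n i j x ->
  homog n (2 ^ i.+1 - 1)%N%:Z (2 ^ i * (2 * j + 1)) (reduce x) /\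
  eqt n (psi (reduce x)) ((1 + 'X) ^+ (2 ^ i * (2 * j + 1)) - 1).
Proof.
move=> le_in [xE xH xZ xV]; set A := (2 ^ i * (2 * j + 1))%N.
have i0 : (0 < 2 ^ i)%N by rewrite expn_gt0.
have hx : homog n (2 ^ i.+1 - 1)%N%:Z A (reduce x).
  move=> m; rewrite mem_reduce => om; have [] := xH m om; have := xE m om.
  rewrite /A /vmon /tdeg /wdeg /te /re /mk /= popc_exp2 expnS => vm h1 h2.
  by split=> //; lia.
split=> // S vS; rewrite coefB coef_binom coef1.
pose f s := (psi (reduce x))`_s; rewrite -/(f S).
have rwi := rw_exp2 i.
have f_small s : (s < 2 ^ i)%N -> f s = 0.
  by move=> /ltn_rw; rewrite rwi => /psi_small; apply; apply: hx.
have [->|S0] := posnP S; first by rewrite f_small // bin0 subrr.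
rewrite subr0.
(* Detection fixes this coefficient: [vmon i j] has rho-exponent 0. *)
have fi : f (2 ^ i)%N = 1.
  have e : cf (vmon i j) (reduce x) = 1 by rewrite -reduce_parity cf_odd xV // eqxx.
  rewrite -e (cf_hom _ hx) /vmon /tdeg /te /re /mk /= popc_exp2.
  rewrite (_ : (_ && _) = true) ?mul1r //.
  by apply/andP; split; apply/eqP; rewrite ?/A !expnS; lia.
have dx : is_zero (d1 n (reduce x)).
  apply/is_zeroP => t; rewrite -(d1_parity n (reduce_parity x)).
  by move: t; apply/is_zeroP.
have fE s u : (0 < u)%N -> valid n s ->
    f u * 'C(A - u, s)%:R = 'C(s + u, s)%:R * f (s + u)%N.
  exact: d1_coef_eq0 hx dx.
have vi : valid n (2 ^ i).
  by case: (n) le_in => //= m le_im; rewrite ltn_exp2l.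
have Ai : 'C(A, 2 ^ i)%:R = 1 :> 'F_2.
  by rewrite natrF2 odd_bin_exp2 /A mulKn // oddD oddM.
(* If 2^i does not divide [S], its remainder T satisfies f_T = 0 and splits off without carry, so
   f_S = 0. *)
have [dS|ndS] := boolP (2 ^ i %| S)%N; last first.
  have -> : 'C(A, S)%:R = 0 :> 'F_2.
    by rewrite natrF2; case: (boolP (odd _)) => // /odd_bin_dvd; rewrite (negbTE ndS).
  have T0 : (0 < S %% 2 ^ i)%N by rewrite lt0n.
  have ltT : (S %% 2 ^ i < 2 ^ i)%N by rewrite ltn_mod.
  have vU : valid n (2 ^ i * (S %/ 2 ^ i)).
    by apply: valid_leq vS; rewrite mulnC leq_divM.
  have := fE _ _ T0 vU; rewrite f_small // mul0r natrF2 odd_bin_disjoint //.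
  by rewrite mulnC -divn_eq mul1r.
have [s eS] := dvdnP dS; rewrite mulnC in eS.
have bAi := bin_mul_bin A (2 ^ i).
(* For odd [s], digit i of [S] is set and splits off, so f_(2^i) determines f_S. *)
have [os|es] := boolP (odd s).
  have [s1|s1] := eqVneq s 1%N; first by rewrite eS s1 muln1 fi Ai.
  pose S' := (2 ^ i * s.-1)%N; have s0 : (0 < s.-1)%N by lia.
  have eSS : S = (2 ^ i + S')%N by rewrite eS /S' -mulnS prednK //; lia.
  have vS' : valid n S' by apply: valid_leq vS; rewrite eSS leq_addl.
  have := fE S' _ i0 vS'; rewrite fi mul1r binCD addnC -eSS.
  have := congr1 (fun k => k%:R : 'F_2) (bAi S').
  rewrite !natrM -eSS Ai mul1r => <- /esym.
  by rewrite (natrF2 'C(S, 2 ^ i)) odd_bin_exp2 eS mulKn // os mul1r mulr1.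
have [ltA|leA] := ltnP A S.
  by rewrite bin_small // [LHS](psi_large hx ltA).
(* For even [s], f_(S+2^i) is computed from f_S and from f_(2^i). Comparing them gives f_S, because
   C(A-S, 2^i) is odd. *)
have := fE _ _ S0 vi; have := fE _ _ i0 vS.
rewrite fi mul1r (addnC S) -binCD => <-.
have := congr1 (fun k => k%:R : 'F_2) (bAi S).
rewrite !natrM Ai mul1r => <-.
have := congr1 (fun k => k%:R : 'F_2) (bin_mul_bin A S (2 ^ i)).
rewrite !natrM (addnC S) -binCD => ->.
have -> : 'C(A - S, 2 ^ i)%:R = 1 :> 'F_2.
  have le_s : (s <= 2 * j + 1)%N by move: leA; rewrite eS /A leq_pmul2l.
  by rewrite natrF2 odd_bin_exp2 eS /A -mulnBr mulKn // oddB // (negbTE es) oddD oddM.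
by rewrite !mulr1.
Qed.

(* v_i(j) v_k(l) - v_i(j + 2^(k-i) l) v_k(0) = 0 in Ext^2_{E(n)}(M_2, M_2);
   the product of classes is represented by the tensor product of cocycles. *)
Theorem mainTheorem7 (n : nbar) (hn : nbar_ge1 n) (i k j l : nat)
  (hik : (i <= k)%N) (hkn : idx_le k n)
  (x y x' y' : gam)
  (hx : is_vrep n i j x) (hy : is_vrep n k l y)
  (hx' : is_vrep n i (j + 2 ^ (k - i) * l) x') (hy' : is_vrep n k 0 y') :
  ext2_zero n (tens n x y ++ tens n x' y').
Proof.
have hin : idx_le i n by case: (n) hkn => //= m; apply: leq_trans.
have [Hx Px] := vrep_psi hin hx; have [Hy Py] := vrep_psi hkn hy.
have [Hx' Px'] := vrep_psi hin hx'; have [Hy' Py'] := vrep_psi hkn hy'.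
have rx := reduce_parity x; have ry := reduce_parity y.
have rx' := reduce_parity x'; have ry' := reduce_parity y'.
move: (reduce x) (reduce y) (reduce x') (reduce y') rx ry rx' ry' Hx Px Hy Py Hx' Px' Hy' Py'.
move=> x0 y0 x1 y1 rx ry rx' ry' Hx Px Hy Py Hx' Px' Hy' Py'.
rewrite muln0 muln1 in Hy' Py'.
have eik : (2 ^ i * 2 ^ (k - i) = 2 ^ k)%N by rewrite -expnD subnKC.
set A := (2 ^ i * (2 * j + 1))%N in Hx Px; set B := (2 ^ k * (2 * l + 1))%N in Hy Py.
set A' := (2 ^ i * _)%N in Hx' Px'.
(* Both products have the same total degree in tau and t. *)
have eA' : (A' + 2 ^ k = A + B)%N.
  rewrite /A' /A /B -eik; move: (2 ^ i)%N (2 ^ (k - i))%N => a b; lia.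
have Bk : odd 'C(B, 2 ^ k) by rewrite odd_bin_exp2 /B mulKn ?expn_gt0 // oddD oddM.
pose t := ((2 ^ i.+1 - 1) + (2 ^ k.+1 - 1))%N.
(* [z] dehomogenizes to the truncation of (1+X)^B - 1 - X^(2^k): tau^A v_k(l) with its tau_k-term
   cancelled. Its rho-exponents are shifted so that its degree is [t]. *)
pose P S := [&& (0 < S)%N, S != (2 ^ k)%N, valid n S & odd 'C(B, S)].
pose z : gam := [seq (A + B - s, rw s - t, s)%N | s <- iota 0 B.+1 & P s].
have Hz : homog n t%:Z (A + B) z.
  move=> m /mapP[S]; rewrite mem_filter mem_iota => /andP[/and4P[S0 Sk vS oS] leS] ->.
  (* This makes the subtraction [rw s - t] exact: [S] is a multiple of 2^k other than 0 and 2^k,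
     hence at least 2^(k+1). *)
  have le_t : (t <= rw S)%N.
    have [q eS] := dvdnP (odd_bin_dvd oS).
    have q2 : (2 ^ k.+1 <= S)%N.
      by rewrite eS expnS leq_mul2r; case: q eS => [|[|q]] eS //; lia.
    have := leq_rw q2; rewrite rw_exp2 /t.
    have : (2 ^ i.+1 <= 2 ^ k.+1)%N by rewrite leq_exp2l.
    by rewrite (expnS 2 k.+1); lia.
  rewrite /tdeg /te /re /mk /=; split=> //; last by lia.
  by have := rwE S; lia.
have Pz S : (psi z)`_S = (P S)%:R.
  rewrite coef_psi /z big_map big_filter.
  have [PS|nPS] := boolP (P S); last first.
    by rewrite big1 // => s Ps; rewrite /mk /=; case: eqP => // e; rewrite -e Ps in nPS.
  have mS : S \in iota 0 B.+1.
    rewrite mem_iota add0n /= ltnS leqNgt; apply/negP => ltB.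
    by case/and4P: PS => _ _ _; rewrite bin_small.
  rewrite big_mkcond (bigD1_seq _ mS (iota_uniq _ _)) /= PS eqxx big1 ?addr0 // => s.
  by move=> /negbTE; rewrite /mk /= => ->; case: ifP.
exists z; split.
  move=> m om; have /Hz[] // : m \in z.
  by rewrite -has_pred1 has_count; case: count om.
apply/is_zeroP => -[g T].
rewrite cf_cat cf_cat (tens_parity n rx ry) (tens_parity n rx' ry').
rewrite (cf_tens_hom _ _ Hx Hy) (cf_tens_hom _ _ Hx' Hy') (cf_d1_hom _ _ Hz).
rewrite -PoszD -/t eA' -!mulrDr.
have [vg|] := boolP (valid n (mk g)); last by rewrite andbF mul0r.
rewrite andbT /d1_coef !Pz; set r := (X in _ * X).
suff -> : r = 0 by rewrite mulr0.
rewrite {}/r; move: (mk g) vg => S vS {g}.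
(* At T = 0 both products vanish, and Delta(z) cancels z (x) 1. *)
have [->|T0] := posnP T.
  rewrite Py ?valid0 // Py' ?valid0 // !coefB !coef_binom !bin0 coef1 subrr !mul0r.
  by rewrite addn0 binn !mul1r !add0r addrF2.
rewrite mul0r addr0.
have [vT|nvT] := boolP (valid n T); last first.
  have nvST : ~~ valid n (S + T)%N.
    by apply: contra nvT; apply: valid_leq; rewrite leq_addl.
  rewrite (psi_invalid Hy nvT) (psi_invalid Hy' nvT) /P (negbTE nvT) (negbTE nvST).
  by rewrite /= !andbF !mul0r !mulr0 !addr0.
have tensE a b (p : {poly 'F_2}) : eqt n p ((1 + 'X) ^+ a - 1) ->
    (p * (1 + 'X) ^+ b)`_S = 'C(a + b, S)%:R + 'C(b, S)%:R.
  move=> eqp; rewrite (eqtM eqp (fun _ _ => erefl)) // mulrBl mul1r -exprD.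
  by rewrite coefB !coef_binom oppF2.
have T0f : (T == 0)%N = false by apply/negbTE; rewrite -lt0n.
rewrite !(tensE _ _ _ Px) !(tensE _ _ _ Px') Py // Py' //.
rewrite !coefB !coef_binom coef1 T0f !subr0.
(* A power of 2 is no carry-free sum of two positive numbers, so for S, T > 0 the exclusion of 2^k
   in [P] is invisible here. *)
have eST : 'C(S + T, S)%:R * (P (S + T)%N)%:R =
    if S == 0%N then (P T)%:R else 'C(B, T)%:R * 'C(B - T, S)%:R :> 'F_2.
  case: eqP => [->|/eqP S0]; first by rewrite bin0 mul1r.
  rewrite -[in RHS]natrM -bin_mul_bin natrM (addnC T) -binCD.
  have [h|nh] := boolP (odd 'C(S + T, S)); last first.
    by rewrite (natrF2 'C(S + T, S)) (negbTE nh) mul0r mulr0.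
  rewrite mulrC; congr (_ * _); rewrite /P addn_gt0 T0 orbT (validD h) //=.
  rewrite [in RHS]natrF2; case: eqP => // e; move: h; rewrite e odd_bin_exp2_eq ?lt0n //.
  by case: eqP => // e'; lia.
rewrite eST.
have PT : (P T)%:R = 'C(B, T)%:R + (T == 2 ^ k)%N%:R :> 'F_2.
  rewrite /P T0 vT /=; case: eqP => [->|_] /=; last by rewrite addr0 -natrF2.
  by rewrite (natrF2 'C(_, _)) Bk addrF2.
rewrite PT (natrF2 'C(2 ^ k, T)) odd_bin_exp2_eq //.
(* For T > B all terms vanish; otherwise A + (B - T) = A + B - T without truncation. *)
have [leT|ltT] := leqP T B; last first.
  have neT : (T == 2 ^ k)%N = false.
    by apply/eqP => e; move: Bk; rewrite -e bin_small.
  by rewrite neT (bin_small ltT) !mul0r !addr0 ?mul0r; case: ifP; rewrite !addr0.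
rewrite -addnBA //.
have [S0|S0] := eqVneq S 0%N.
  by rewrite S0 !bin0 !addrF2 !mulr0 !add0r mulr1 addrF2.
(* The second product contributes only at T = 2^k, where its C(A', S) cancels that of the first
   product because A + B - 2^k = A'. *)
case: eqP => [eT|_].
  rewrite eT subnn addn0 bin0n (negbTE S0).
  have -> : (A + (B - 2 ^ k) = A')%N by lia.
  rewrite (natrF2 'C(B, 2 ^ k)) Bk addrF2 !mul1r mul0r addr0 add0r.
  by rewrite -addrA addrF2.
by rewrite mul0r !addr0 -mulrDr addrF2.
Qed.
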